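(* Let $D_2$ be a non-abelian finite group admitting an abelian subgroup $A$ of index $2$, with the presentation $$D_2=\langle A,b\mid b^2=y,\ bab^{-1}=f(a)\ (a\in A)\rangle ,$$ where $A$ is a finite abelian group of order $n\ge 3$, $f\in\mathrm{Aut}(A)$ is of order $2$, and $y\in A$ satisfies $f(y)=y$. Write $A\cong\langle a_1\rangle\times\cdots\times\langle a_{\lambda+\mu}\rangle$ with $\langle a_i\rangle\cong C_{p_i^{e_i}}$, where the $p_i$ are primes, $\lambda+\mu\ne 0$, and $p_i=2$ if and only if $1\le i\le\lambda$. Since $f\in\mathrm{Aut}(A)$, there are integers $s_1,\ldots,s_{\lambda+\mu}$ such that $f((a_1,\ldots,a_{\lambda+\mu}))=(a_1^{s_1},\ldots,a_{\lambda+\mu}^{s_{\lambda+\mu}})$, i.e. $f$ acts on the $i$-th cyclic factor by $x\mapsto x^{s_i}$; put $d_i=\gcd(s_i-1,p_i^{e_i})$. Then $D_2$ is triply transitive and $$\dim_{\mathbb C}\mathcal T(D_2)=\tfrac12\left(3nd+n^2+4d^2\right),$$ where $d=\prod_{i=1}^{\lambda+\mu}d_i$ and $n=|A|$.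
   Context: In the presentation of $D_2$ it is understood that the relations of $A$ hold; $D_2$ has order $2n$, and each of its elements is uniquely of the form $a$ or $ab$ with $a\in A$. For a finite group $G$ with identity $e$ and conjugacy classes $\mathbf{Cl}_0=\{e\},\mathbf{Cl}_1,\ldots,\mathbf{Cl}_\ell$, let $N_i$ be the $|G|\times|G|$ complex $0/1$-matrix (rows and columns indexed by $G$) with $(N_i)_{x,y}=1$ iff $yx^{-1}\in\mathbf{Cl}_i$, and let $E_i^*$ be the diagonal matrix with $(u,u)$ entry $(N_i)_{e,u}$, i.e. $1$ if $u\in\mathbf{Cl}_i$ and $0$ otherwise. The Terwilliger algebra $\mathcal T(G)$ (of the group association scheme of $G$, with respect to $e$) is the subalgebra of $M_{|G|}(\mathbb C)$ generated by all $N_i$ and all $E_i^*$, $0\le i\le \ell$. Let $\mathcal T_0(G)=\mathrm{Span}_{\mathbb C}\{E_i^*N_jE_k^*\mid 0\le i,j,k\le\ell\}$. For $g\in G$ let $\pi_g$ be the permutation matrix with $(\pi_g)_{x,y}=1$ if $gxg^{-1}=y$ and $0$ otherwise, and let $\widetilde{\mathcal T}(G)$ be the algebra of all $|G|\times|G|$ complex matrices commuting with $\pi_g$ for every $g\in G$. One has $\mathcal T_0(G)\subseteq\mathcal T(G)\subseteq\widetilde{\mathcal T}(G)$; $G$ is called triply transitive if $\mathcal T_0(G)=\widetilde{\mathcal T}(G)$.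
   Formalization: That f acts on each cyclic factor by x ↦ x^{s_i} is assumed, not derived from f ∈ Aut(A): such s_i need not exist (swap the two factors of C_2×C_2), and then d is undefined. *)

(* Defs.v *)
From HB Require Import structures.
From mathcomp Require Import all_boot all_order all_algebra all_fingroup all_solvable all_field.
From mathcomp Require Import complex reals.
Set Implicit Arguments.
Unset Strict Implicit.
Unset Printing Implicit Defensive.

Import GRing.Theory.
Local Open Scope ring_scope.

(* Matrices with rows and columns indexed by the elements of G are square
   matrices of size #|G|; the size is written #|G|.-1.+1 (equal to #|G|, as G
   contains 1) so that they form a falgType. *)
Notation "''MG[' F ]_ G" := 'M[F]_(#|G|.-1.+1)
  (at level 8, F at level 200, G at level 2, format "''MG[' F ]_ G").

Section Terwilliger.
Variables (F : fieldType) (gT : finGroupType) (G : {group gT}).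

Definition elt (x : 'I_(#|G|.-1.+1)) : gT :=
  enum_val (cast_ord (prednK (cardG_gt0 G)) x).

(* The conjugacy classes of G are indexed by themselves, that is, by the
   elements of classes G, rather than by 0, ..., l;
   adj_mx is the N_i and dual_idem the E_i^* of the literature. *)
Definition adj_mx (C : {set gT}) : 'MG[F]_G :=
  \matrix_(x, y) ((elt y * (elt x)^-1)%g \in C)%:R.

Definition dual_idem (C : {set gT}) : 'MG[F]_G :=
  diag_mx (\row_u (elt u \in C)%:R).

Definition conj_mx (g : gT) : 'MG[F]_G :=
  \matrix_(x, y) ((g * elt x * g^-1)%g == elt y)%:R.

(* agenv is the generated unital subalgebra; here the unit is a generator, as
   adj_mx [set 1] = 1. *)
Definition terwilliger : {vspace 'MG[F]_G} :=
  agenv (\sum_(C in classes G) (<[adj_mx C]> + <[dual_idem C]>))%VS.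

Definition terwilliger0 : {vspace 'MG[F]_G} :=
  (\sum_(Ci in classes G) \sum_(Cj in classes G) \sum_(Ck in classes G)
     <[dual_idem Ci *m adj_mx Cj *m dual_idem Ck]>)%VS.

Definition terwilliger_tilde : {vspace 'MG[F]_G} :=
  (\bigcap_(g in G) 'C[conj_mx g])%VS.

Definition triply_transitive : Prop := terwilliger0 = terwilliger_tilde.

End Terwilliger.

Definition expgz (gT : finGroupType) (x : gT) (z : int) : gT :=
  match z with
  | Posz k => (x ^+ k)%g
  | Negz k => (x ^- k.+1)%g
  end.

(* D has the presentation < A, b | b^2 = y, b a b^-1 = f a (a in A) >, the
   relations of A being understood. When f \in Aut A has order 2 and f y = y,
   the group so presented has order 2 |A|, hence a group generated by A and b
   in which the relations hold is that group exactly when #|D : A| = 2. *)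
Record D2_presentation (gT : finGroupType) (D A : {group gT}) (b y : gT)
    (f : {perm gT}) : Prop := D2Presentation {
  D2_sub : A \subset D;
  D2_index : #|D : A|%g = 2%N;
  D2_gen : <<b |: A>>%g = D;
  D2_sqr : (b ^+ 2)%g = y;
  D2_conj : forall a, a \in A -> (b * a * b^-1)%g = f a
}.

(* Main.v *)
Require Import Defs.
From HB Require Import structures.
From mathcomp Require Import all_boot all_order all_algebra all_fingroup all_solvable all_field.
From mathcomp Require Import complex reals zify lra.
Set Implicit Arguments.
Unset Strict Implicit.
Unset Printing Implicit Defensive.
Import GRing.Theory.
Local Open Scope ring_scope.

(* A matrix commutes with all conj_mx g iff it is constant on the orbits of the
   diagonal conjugation action of D on D x D, so the dimension of
   terwilliger_tilde is the number of these orbits, which Burnside's lemma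
   evaluates from the centraliser orders: 2n on 'Z(D), n on A \ 'Z(D) and
   2 #|'Z(D)| off A.  The product E_i^* N_j E_k^* is the indicator of the pairs
   (x, y) with x, y x^-1, y in given classes, a union of orbits; triple
   transitivity says that such a union is a single orbit.  Of x, y and y x^-1
   either exactly one or all three lie in A.  If u is in A and v is not, the
   class of v is already its A-orbit and A fixes u, so u and v can be conjugated
   independently.  If all three are in A, conjugation by g only depends on
   whether g is in A, and of three bits two must agree.  Finally 'Z(D) is the
   set of fixed points of f in A, counted factor by factor. *)

(** * Orbits of a group on pairs of its elements under simultaneous conjugation *)

Section DiagonalConjugation.
Variables (gT : finGroupType) (G : {group gT}).

Definition conj_pair (u : gT * gT) (g : gT) : gT * gT := (u.1 ^ g, u.2 ^ g)%g.

Lemma conj_pair1 : conj_pair^~ 1%g =1 id.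
Proof. by case=> x y; rewrite /conj_pair !conjg1. Qed.

Lemma conj_pairM u : act_morph conj_pair u.
Proof. by move=> g h; rewrite /conj_pair /= !conjgM. Qed.

Canonical conj_pair_action := TotalAction conj_pair1 conj_pairM.

Definition pair_orbits : {set {set gT * gT}} :=
  orbit conj_pair_action G @: setX G G.

Lemma acts_conj_pair : [acts G, on setX G G | conj_pair_action].
Proof.
apply/actsP=> g Gg [x y].
by rewrite !in_setX /= /conj_pair /= !memJ_norm // (subsetP (normG G)).
Qed.

Lemma mem_orbit_conj_pair x y g :
  g \in G -> (x ^ g, y ^ g)%g \in orbit conj_pair_action G (x, y).
Proof. exact: (@mem_orbit _ _ _ conj_pair_action _ (x, y)). Qed.

(** The pairs fixed by [g] form the square of ['C_G[g]], so this is the Cauchy-Frobenius formula. *)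
Lemma card_pair_orbits :
  (\sum_(g in G) #|'C_G[g]%g| ^ 2 = #|pair_orbits| * #|G|)%N.
Proof.
rewrite -(Frobenius_Cauchy acts_conj_pair); apply: eq_bigr => g Gg.
rewrite -mulnn -cardsX; congr #|pred_of_set _|; apply/setP=> -[x y].
have cE z : (z \in 'C[g]%g) = ((z ^ g)%g == z).
  by rewrite cent1E -[RHS](inj_eq (mulgI g)) -conjgC.
rewrite in_setX !in_setI in_setX !cE.
by rewrite (sameP (@afix1P _ _ _ conj_pair_action _ _) eqP) xpair_eqE andbACA.
Qed.

End DiagonalConjugation.

(** * Indicator matrices of sets of pairs, and the three matrix spaces *)

Section PairMatrices.
Variables (F : fieldType) (gT : finGroupType) (G : {group gT}).
Local Notation I := 'I_(#|G|.-1.+1).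
Implicit Types (i j k l : I) (M : 'MG[F]_G).

Lemma elt_in i : elt i \in G.
Proof. exact: enum_valP. Qed.

Lemma elt_inj : injective (@elt gT G).
Proof. by move=> i j /enum_val_inj /cast_ord_inj. Qed.

Lemma elt_surj x : x \in G -> {i : I | elt i = x}.
Proof.
move=> Gx; exists (cast_ord (esym (prednK (cardG_gt0 G))) (enum_rank_in Gx x)).
by rewrite /elt cast_ordKV enum_rankK_in.
Qed.

Definition pair_mx (S : {set gT * gT}) : 'MG[F]_G :=
  \matrix_(i, j) ((elt i, elt j) \in S)%:R.

(** [conj_mx] uses [g x g^-1] whereas [x ^ g] is [g^-1 x g]; hence row [k] of [conj_mx F G g] has
    its only 1 in column [i]. *)
Lemma conj_mx_mulE g i j k M : elt k = (elt i ^ g)%g ->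
  (conj_mx F G g *m M) k j = M i j /\ (M *m conj_mx F G g) j i = M j k.
Proof.
move=> ek; split; rewrite mxE.
  rewrite (bigD1 i) //= mxE ek conjgE !mulgA mulgV mul1g mulgK eqxx mul1r.
  rewrite big1 ?addr0 // => h; rewrite mxE ek conjgE !mulgA mulgV mul1g mulgK.
  by rewrite (inj_eq elt_inj) eq_sym => /negPf->; rewrite mul0r.
have e h : ((g * elt h * g^-1)%g == elt i) = (h == k).
  rewrite -(inj_eq elt_inj) ek -(inj_eq (conjg_inj g)).
  by rewrite !conjgE !mulgA mulVg mul1g mulgKV.
rewrite (bigD1 k) //= mxE e eqxx mulr1 big1 ?addr0 // => h /negPf hk.
by rewrite mxE e hk mulr0.
Qed.

Lemma mem_terwilliger_tilde M :
  M \in terwilliger_tilde F G <->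
  forall g i j k l, g \in G -> elt k = (elt i ^ g)%g -> elt l = (elt j ^ g)%g ->
    M k l = M i j.
Proof.
split=> [MT g i j k l Gg ek el | MT].
  have /cent1vP MC : M \in 'C[conj_mx F G g]%VS.
    by move: MT; rewrite memvE => /subv_bigcapP/(_ g Gg).
  have [<- _] := conj_mx_mulE j M ek; have [_ <-] := conj_mx_mulE k M el.
  by move/matrixP: MC => /(_ k j).
rewrite memvE; apply/subv_bigcapP=> g Gg; rewrite -memvE; apply/cent1vP.
apply/matrixP=> k j.
have [i ei] := elt_surj (groupJ (elt_in k) (groupVr Gg)).
have [l el] := elt_surj (groupJ (elt_in j) Gg).
have ek : elt k = (elt i ^ g)%g by rewrite ei conjgKV.
have [e1 _] := conj_mx_mulE j M ek; have [_ e2] := conj_mx_mulE k M el.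
by rewrite [LHS]e2 [RHS]e1; apply: MT ek el.
Qed.

Lemma pair_mx_tilde S :
  [acts G, on S | conj_pair_action gT] -> pair_mx S \in terwilliger_tilde F G.
Proof.
move=> actS; apply/mem_terwilliger_tilde=> g i j k l Gg ek el.
rewrite !mxE ek el; congr (nat_of_bool _)%:R.
exact: (actsP actS g Gg (elt i, elt j)).
Qed.

Lemma terwilliger_tildeE :
  terwilliger_tilde F G = (\sum_(O in pair_orbits G) <[pair_mx O]>)%VS.
Proof.
apply: subv_anti; apply/andP; split; last first.
  apply/subv_sumP=> O /imsetP[u _ ->]; rewrite -memvE.
  exact/pair_mx_tilde/acts_orbit/subsetT.
apply/subvP=> M /mem_terwilliger_tilde MT.
(* [c O] is the value of [M] at some pair of [O], by invariance at every pair; the default 0 never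
   occurs for an orbit in [pair_orbits G], which is non-empty. *)
pose c (O : {set gT * gT}) :=
  if [pick ij : I * I | (elt ij.1, elt ij.2) \in O] is Some ij
  then M ij.1 ij.2 else 0.
have -> : M = \sum_(O in pair_orbits G) c O *: pair_mx O.
  apply/matrixP=> i j; rewrite summxE.
  have Oij : orbit (conj_pair_action gT) G (elt i, elt j) \in pair_orbits G.
    by apply: imset_f; rewrite in_setX !elt_in.
  rewrite (bigD1 _ Oij) /= !mxE orbit_refl mulr1 big1 ?addr0.
    rewrite /c; case: pickP => [[k l] /= /orbitP[g Gg [ek el]]|].
      by apply/esym/(MT g).
    by move/(_ (i, j)); rewrite /= orbit_refl.
  move=> O /andP[/imsetP[u _ ->] neq]; rewrite !mxE.
  case: orbit_eqP => [e|_]; last by rewrite mulr0.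
  by rewrite e eqxx in neq.
by apply: memv_sumr => O _; rewrite memvZ // memv_line.
Qed.

(** Distinct orbits are disjoint and non-empty, so their indicators are non-zero with disjoint
    supports, hence independent. *)
Lemma dim_terwilliger_tilde : \dim (terwilliger_tilde F G) = #|pair_orbits G|.
Proof.
have nz O : O \in pair_orbits G ->
    exists ij : I * I, O = orbit (conj_pair_action gT) G (elt ij.1, elt ij.2).
  case/imsetP=> -[x y]; rewrite in_setX /= => /andP[Gx Gy] ->.
  have [[i <-] [j <-]] := (elt_surj Gx, elt_surj Gy).
  by exists (i, j).
rewrite terwilliger_tildeE (directvP _) /=.
  rewrite -[RHS]sum1_card; apply: eq_bigr => O /nz[ij ->]; rewrite dim_vline.
  case: eqP => // /matrixP/(_ ij.1 ij.2)/eqP.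
  by rewrite !mxE orbit_refl oner_eq0.
apply/directv_sum_independent=> us usE us0 O PO.
have [c uE] : exists c, us O = c *: pair_mx O by apply/vlineP/usE.
have [[i j] /= eO] := nz O PO.
move/matrixP/(_ i j): us0; rewrite summxE (bigD1 O) //= big1 ?addr0.
  by rewrite uE !mxE eO orbit_refl mulr1 => ->; rewrite scale0r.
move=> O' /andP[PO' neq]; have /vlineP[c' ->] := usE _ PO'.
have [[i' j'] /= eO'] := nz O' PO'.
rewrite !mxE eO'; case: orbit_eqP => [e|_]; last by rewrite mulr0.
by rewrite eO' eO e eqxx in neq.
Qed.

Lemma adj_mxE (C : {set gT}) :
  adj_mx F G C = pair_mx [set u | (u.2 * u.1^-1)%g \in C].
Proof. by apply/matrixP=> i j; rewrite !mxE inE. Qed.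

Lemma dual_idemE (C : {set gT}) :
  dual_idem F G C = pair_mx [set u | (u.1 == u.2) && (u.1 \in C)].
Proof.
apply/matrixP=> i j; rewrite !mxE inE /= (inj_eq elt_inj).
by case: eqP => [->|_]; rewrite ?mulr1n ?mulr0n.
Qed.

Lemma sandwichE (Ci Cj Ck : {set gT}) :
  dual_idem F G Ci *m adj_mx F G Cj *m dual_idem F G Ck =
  pair_mx [set u | [&& u.1 \in Ci, (u.2 * u.1^-1)%g \in Cj & u.2 \in Ck]].
Proof.
apply/matrixP=> i j; rewrite mul_mx_diag mul_diag_mx !mxE inE /=.
by do 3!case: (_ \in _); rewrite ?mulr1 ?mulr0 ?mul0r.
Qed.

Lemma terwilliger_sub_tilde : (terwilliger F G <= terwilliger_tilde F G)%VS.
Proof.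
have memC C g z : C \in classes G -> g \in G -> ((z ^ g)%g \in C) = (z \in C).
  move=> /imsetP[x _ ->] Gg; apply/idP/idP=> /imsetP[h Gh e].
    apply/imsetP; exists (h * g^-1)%g; first by rewrite groupM ?groupV.
    by rewrite conjgM -e conjgK.
  by apply/imsetP; exists (h * g)%g; rewrite ?groupM // conjgM -e.
rewrite /terwilliger; set U := (X in agenv X).
have UT : (U <= terwilliger_tilde F G)%VS.
  apply/subv_sumP=> C clC; rewrite subv_add -!memvE adj_mxE dual_idemE.
  by apply/andP; split; apply: pair_mx_tilde; apply/actsP=> g Gg [x y];
    rewrite !inE /= -?conjVg -?conjMg memC ?(inj_eq (conjg_inj g)).
(* Each centraliser [V] is a unital algebra, so it contains the algebra generated by [U] once it
   contains [U]. *)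
apply/subv_bigcapP=> g Gg; set V := 'C[conj_mx F G g]%VS.
have UV : (U <= V)%VS by move/subv_bigcapP: UT; apply.
apply: agenv_sub_modr; first by rewrite -memvE; apply: cent1v1.
exact: subv_trans (prodvS (subvv _) UV) (asubv _).
Qed.

Lemma terwilliger0_sub : (terwilliger0 F G <= terwilliger F G)%VS.
Proof.
have genT C : C \in classes G ->
    adj_mx F G C \in terwilliger F G /\ dual_idem F G C \in terwilliger F G.
  move=> clC; rewrite !memvE; split; apply: subv_trans (sub_agenv _);
    apply: (sumv_sup C) => //; [exact: addvSl | exact: addvSr].
apply/subv_sumP=> Ci clCi; apply/subv_sumP=> Cj clCj; apply/subv_sumP=> Ck clCk.
rewrite -memvE; have [_ Ei] := genT _ clCi; have [Nj _] := genT _ clCj.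
have [_ Ek] := genT _ clCk.
by rewrite /terwilliger -agenvM memv_mul // -agenvM memv_mul.
Qed.

(** Under the hypothesis, the indicator of the orbit of [(x, y)] is itself a generator of
    [terwilliger0], namely the one for the classes of [x], [y * x^-1] and [y]. *)
Lemma triply_transitive_criterion :
    (forall x y x' y', x \in G -> y \in G -> x' \in (x ^: G)%g ->
       y' \in (y ^: G)%g ->
       (y' * x'^-1)%g \in ((y * x^-1) ^: G)%g ->
       exists2 g, g \in G & (x' = x ^ g /\ y' = y ^ g)%g) ->
  triply_transitive F G.
Proof.
move=> orbG; apply: subv_anti.
rewrite (subv_trans terwilliger0_sub terwilliger_sub_tilde) /=.
rewrite terwilliger_tildeE; apply/subv_sumP=> O /imsetP[[x y]].
rewrite in_setX /= => /andP[Gx Gy] ->.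
have Gz : (y * x^-1)%g \in G by rewrite groupM ?groupV.
apply: (sumv_sup (x ^: G)%g); first exact: mem_classes.
apply: (sumv_sup ((y * x^-1) ^: G)%g); first exact: mem_classes.
apply: (sumv_sup (y ^: G)%g); first exact: mem_classes.
rewrite sandwichE; set T := [set _ | _].
suff -> : orbit (conj_pair_action gT) G (x, y) = T by apply: subvv.
apply/setP=> -[x' y'].
rewrite [in RHS]inE /=; apply/idP/and3P => /= [/orbitP[g Gg [<- <-]] | [Hx Hz Hy]].
  by rewrite -conjVg -conjMg !memJ_class.
have [g Gg [-> ->]] := orbG _ _ _ _ Gx Gy Hx Hy Hz.
exact: mem_orbit_conj_pair.
Qed.

Lemma terwilliger_triply : triply_transitive F G ->
  terwilliger F G = terwilliger_tilde F G.
Proof.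
move=> tG; apply: subv_anti; rewrite terwilliger_sub_tilde /= -tG.
exact: terwilliger0_sub.
Qed.

End PairMatrices.

(** * Counting fixed points of power maps and of automorphisms of direct products *)

Lemma expgz_fixE (gT : finGroupType) (x : gT) (s : int) :
  (expgz x s == x) = (#[x]%g %| `|s - 1|)%N.
Proof.
rewrite order_dvdn; case: s => [[|k]|k].
- by rewrite /= expg0 expg1 eq_sym.
- rewrite (_ : k.+1%:Z - 1 = k); last by rewrite -addn1 PoszD addrK.
  by rewrite eq_mulgV1 /= expgSr mulgK.
- rewrite NegzE -opprD abszN -PoszD addn1 absz_nat /=.
  by rewrite eq_sym eq_mulgV1 invgK -expgS.
Qed.

Lemma card_cycle_order_dvdn (gT : finGroupType) (x : gT) d :
  (d %| #[x]%g)%N -> #|[set z in <[x]>%g | #[z]%g %| d]%N| = d.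
Proof.
move=> d_dv; have d_gt0 : (0 < d)%N by apply: dvdn_gt0 d_dv; apply: order_gt0.
have ed : #[x ^+ (#[x] %/ d)]%g = d.
  by rewrite orderXdiv ?dvdn_div // divnA // mulKn.
transitivity #[x ^+ (#[x] %/ d)]%g => //; rewrite orderE.
congr #|pred_of_set _|; apply/setP=> z; rewrite inE.
apply/andP/idP=> [[/cycleP[i ->]] | zX]; last first.
  split; last by rewrite -[X in (_ %| X)%N]ed order_dvdG.
  by apply: subsetP zX; rewrite cycle_subG mem_cycle.
(* [x ^+ i] has order dividing [d] iff [#[x]] divides [i * d], that is, iff [#[x] %/ d] divides
   [i]. *)
rewrite order_dvdn -expgM -order_dvdn -[X in (X %| _)%N](divnK d_dv).
by rewrite dvdn_pmul2r // => /dvdnP[k ->]; rewrite mulnC expgM mem_cycle.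
Qed.

(** [z] is fixed iff its order divides [s - 1]; as that order divides [#[x]] anyway, it must divide
    the gcd. This count is the factor [d_i] of the theorem. *)
Lemma card_cycle_expgz_fix (gT : finGroupType) (x : gT) (s : int) :
  #|[set z in <[x]>%g | expgz z s == z]| = gcdn `|s - 1| #[x]%g.
Proof.
rewrite -[RHS](@card_cycle_order_dvdn _ x) ?dvdn_gcdr //.
congr #|pred_of_set _|; apply/setP=> z; rewrite !inE expgz_fixE.
by case: (boolP (z \in _)) => //= zx; rewrite dvdn_gcd order_dvdG ?andbT.
Qed.

(** Since [f] preserves every factor, uniqueness of the decomposition makes [x] fixed iff all its
    components are. *)
Lemma card_bigdprod_fix (gT : finGroupType) (I : finType) (H : I -> {group gT})
    (A : {group gT}) (f : {perm gT}) :
    (\big[dprod/1]_i H i)%g = A -> f \in Aut A ->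
    (forall i x, x \in H i -> f x \in H i) ->
  #|[set x in A | f x == x]| = (\prod_i #|[set x in H i | f x == x]|)%N.
Proof.
move=> defA fA fH; pose S i := [set x in H i | f x == x].
rewrite -[RHS](cardsXn S).
pose prodf (c : {dffun forall i : I, gT}) := (\prod_i c i)%g.
have sHA i x : x \in H i -> x \in A.
  by apply: subsetP; rewrite -(bigdprodWY defA) sub_gen // (bigcup_max i).
have fprod c : (forall i, c i \in H i) ->
    f (\prod_i c i)%g = (\prod_i f (c i))%g.
  move=> cH; rewrite -(autmE fA) (morph_prod [morphism of autm fA]) // => i _.
  exact: sHA.
have mem_prod c : (forall i, c i \in H i) -> (\prod_i c i)%g \in A.
  by move=> cH; rewrite -(bigdprodW defA) mem_prodg.
have uniq_prod c c' : (forall i, c i \in H i) -> (forall i, c' i \in H i) ->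
    (\prod_i c i = \prod_i c' i)%g -> c =1 c'.
  move=> cH c'H e i; have [c0 [_ _ uni]] := mem_bigdprod defA (mem_prod c cH).
  by rewrite (uni c) // (uni c') // => j _; apply: c'H.
rewrite -(card_in_imset (f := prodf) (D := setXn S)) => [|c c' Sc Sc' e]; last first.
  apply/ffunP; apply: uniq_prod e => i.
    by move: Sc; rewrite in_setXn => /forallP/(_ i); rewrite inE => /andP[].
  by move: Sc'; rewrite in_setXn => /forallP/(_ i); rewrite inE => /andP[].
congr #|pred_of_set _|; apply/setP=> x; rewrite inE.
apply/andP/imsetP=> [[Ax /eqP fx] | [c Sc ->]].
  have [c [cH xE _]] := mem_bigdprod defA Ax.
  have {}cH i : c i \in H i by apply: cH.
  exists [ffun i => c i]; last by rewrite xE; apply: eq_bigr => i _; rewrite ffunE.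
  rewrite in_setXn; apply/forallP=> i; rewrite ffunE inE cH /=; apply/eqP.
  (* As [f x = x], both [c] and [f \o c] are decompositions of [x], so they agree. *)
  apply: (uniq_prod (f \o c) c) => [j|//|]; first exact: fH.
  by rewrite -fprod // -xE.
have cH i : c i \in H i /\ f (c i) = c i.
  by move: Sc; rewrite in_setXn => /forallP/(_ i); rewrite inE => /andP[? /eqP].
split; first by apply: mem_prod => i; case: (cH i).
rewrite fprod => [|i]; last by case: (cH i).
by apply/eqP/eq_bigr=> i _; case: (cH i).
Qed.

(** * Non-abelian groups with an abelian subgroup of index two *)

Section AbelianIndexTwo.
Variables (gT : finGroupType) (D A : {group gT}).
Hypotheses (sAD : A \subset D) (indexA : #|D : A|%g = 2%N).
Hypotheses (abelA : abelian A) (nabelD : ~~ abelian D).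
Local Open Scope group_scope.

Let cardD : #|D| = (2 * #|A|)%N.
Proof. by rewrite -(Lagrange sAD) indexA mulnC. Qed.

Let cardDA : #|D :\: A| = #|A|.
Proof. by rewrite cardsD (setIidPr sAD) cardD mul2n -addnn addnK. Qed.

Lemma mem_conj_index2 x g : g \in D -> (x ^ g \in A) = (x \in A).
Proof.
move=> Dg; rewrite memJ_norm //; apply: subsetP Dg.
exact/normal_norm/index2_normal.
Qed.

Lemma index2_divg g h :
  g \in D -> g \notin A -> h \in D -> h \notin A -> g^-1 * h \in A.
Proof.
move=> Dg nAg Dh nAh; rewrite -mem_lcoset.
suff -> : g *: A = D :\: A by rewrite inE nAh.
apply/eqP; rewrite eqEcard card_lcoset cardDA leqnn andbT.
apply/subsetP=> _ /lcosetP[a Aa ->]; rewrite inE groupMr // nAg.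
by rewrite groupM // (subsetP sAD).
Qed.

(** [A] acts trivially on itself, so conjugation of [u] depends only on the coset of [A] containing
    the conjugator. *)
Lemma conj_abel_eq u g h : u \in A -> g \in D -> h \in D ->
  (g \in A) = (h \in A) -> u ^ g = u ^ h.
Proof.
have trivJ v k : v \in A -> k \in A -> v ^ k = v.
  by move=> Av Ak; rewrite conjgE (centsP abelA v _ k) // mulKg.
move=> Au Dg Dh; case: (boolP (h \in A)) => [Ah Ag | nAh nAg].
  by rewrite !trivJ.
have Agh : g^-1 * h \in A by rewrite index2_divg ?nAg.
by rewrite -[h](mulKVg g) conjgM [RHS]trivJ // mem_conj_index2.
Qed.

Lemma conj_pair_mixed x y x' y' :
    x \in A -> y \in D -> y \notin A -> x' \in x ^: D -> y' \in y ^: D ->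
  exists2 g, g \in D & x' = x ^ g /\ y' = y ^ g.
Proof.
move=> Ax Dy nAy /imsetP[g Dg ->] /imsetP[h Dh ->].
have Du : g^-1 * h \in D by rewrite groupM ?groupV.
have [Au | nAu] := boolP (g^-1 * h \in A).
  exists h => //; split=> //; apply: conj_abel_eq => //.
  by rewrite -[h](mulKVg g) groupMr.
have Ac : (y ^ g)^-1 * (g^-1 * h) \in A.
  by apply: index2_divg; rewrite ?mem_conj_index2 // groupJ.
have Dyh : y^-1 * h \in D by rewrite groupM ?groupV.
(* Conjugation by [y^-1] fixes [y], so [y^-1 * h] sends [y] to [y ^ h]; since [y] is outside [A],
   this conjugator lies in the coset of [g] rather than that of [h]. *)
exists (y^-1 * h) => //; split; last first.
  by rewrite conjgM [in RHS](_ : y ^ y^-1 = y) // conjgE mulgV mulg1 invgK.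
apply: conj_abel_eq => //; rewrite -(groupMr g Ac) conjgE.
by rewrite !invMg invgK !mulgA mulgV mul1g mulgK.
Qed.

Lemma conj_triple_abelian_index2 x y x' y' :
    x \in D -> y \in D -> x' \in x ^: D -> y' \in y ^: D ->
    y' * x'^-1 \in (y * x^-1) ^: D ->
  exists2 g, g \in D & x' = x ^ g /\ y' = y ^ g.
Proof.
move=> Dx Dy clx cly clz.
have [Ax | nAx] := boolP (x \in A); have [Ay | nAy] := boolP (y \in A).
- have [[g Dg ex] [h Dh ey]] := (imsetP clx, imsetP cly).
  have [k Dk ez] := imsetP clz.
  (* Two of the conjugators [g], [h], [k] lie in the same coset of [A], so one element serves two of
     [x], [y], [y * x^-1]; the third is determined by these two. *)
  have [egh | ngh] := eqVneq (g \in A) (h \in A).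
    by exists h; rewrite // ex ey (conj_abel_eq Ax Dg Dh egh).
  have [egk | ngk] := eqVneq (g \in A) (k \in A).
    have exk : x' = x ^ k by rewrite ex (conj_abel_eq Ax Dg Dk egk).
    by exists k; rewrite // -[y'](mulgKV x') ez exk -conjMg mulgKV.
  have ehk : (h \in A) = (k \in A).
    by case: (g \in A) (h \in A) (k \in A) ngh ngk => [] [] [].
  have eyk : y' = y ^ k by rewrite ey (conj_abel_eq Ay Dh Dk ehk).
  exists k => //; split=> //; apply: invg_inj; apply: (mulgI y').
  by rewrite ez eyk conjMg conjVg.
- exact: conj_pair_mixed.
- by have [g Dg [ey ex]] := conj_pair_mixed Ay Dx nAx cly clx; exists g.
(* With [x] and [y] both outside [A], the mixed case applies to [y * x^-1] and [x], and [y] is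
   recovered as their product. *)
have Az : y * x^-1 \in A by rewrite -[y]invgK index2_divg ?groupV.
have [g Dg [ez ex]] := conj_pair_mixed Az Dx nAx clz clx.
by exists g => //; split=> //; rewrite -[y'](mulgKV x') ez ex -conjMg mulgKV.
Qed.

(** [D] is generated by [A] and any [g] outside [A]: an [h] outside [A] is [g] times an element of
    [A]. *)
Lemma cent1_index2 g z :
  g \in D -> g \notin A -> z \in 'C(A) -> commute z g -> z \in 'C(D).
Proof.
move=> Dg nAg cAz czg; apply/centP=> h Dh.
have [Ah | nAh] := boolP (h \in A); first exact: (centP cAz).
rewrite -[h](mulKVg g); apply: commuteM => //.
by apply: (centP cAz); apply: index2_divg.
Qed.

(** Given a central [z] outside [A], whatever centralises [A] is central in [D]. This applies first
    to [A] itself, then to all of [D], which would be abelian. *)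
Lemma center_sub_abelian_index2 : 'Z(D) \subset A.
Proof.
apply/subsetP=> z /centerP[Dz cDz]; apply: contraR nabelD => nAz.
have czD x : x \in D -> x \in 'C(A) -> x \in 'C(D).
  by move=> Dx cAx; apply: (cent1_index2 Dz nAz) => //; apply/esym/cDz.
have sACD : A \subset 'C(D).
  by apply/subsetP=> a Aa; rewrite czD ?(subsetP sAD) ?(subsetP abelA).
by apply/subsetP=> x Dx; rewrite czD // (subsetP _ x Dx) // centsC.
Qed.

Lemma cent1_abelian_index2 g : g \in A -> g \notin 'Z(D) -> 'C_D[g] = A.
Proof.
move=> Ag; apply: contraNeq => neq.
have Dg : g \in D by apply: subsetP Ag.
have sAC : A \subset 'C_D[g] by rewrite subsetI sAD sub_cent1 (subsetP abelA).
have [h] : exists2 h, h \in 'C_D[g] & h \notin A.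
  by apply/subsetPn; apply: contra neq => sCA; rewrite eqEsubset sCA.
rewrite inE => /andP[Dh /cent1P chg] nAh; rewrite inE Dg.
by apply: (cent1_index2 Dh) => //; apply: (subsetP abelA).
Qed.

(** ['C_D[g]] meets [A] in ['Z(D)] and, containing [g], satisfies [A * 'C_D[g] = D]; the product
    formula gives its order. *)
Lemma card_cent1_index2 g :
  g \in D -> g \notin A -> #|'C_D[g]| = (2 * #|'Z(D)|)%N.
Proof.
move=> Dg nAg; have CDg : g \in 'C_D[g] by rewrite inE Dg cent1id.
have ZE : A :&: 'C_D[g] = 'Z(D).
  apply/setP=> z; rewrite inE; apply/andP/idP=> [[Az] | Zz].
    rewrite inE => /andP[Dz /cent1P czg]; rewrite inE Dz.
    by apply: (cent1_index2 Dg) => //; apply: (subsetP abelA).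
  split; first exact: (subsetP center_sub_abelian_index2).
  have /centerP[Dz cz] := Zz; rewrite inE Dz; apply/cent1P; exact: cz.
have AC : A * 'C_D[g] = D.
  apply/eqP; rewrite eqEsubset mul_subG ?subsetIl //=.
  apply/subsetP=> h Dh; have [Ah | nAh] := boolP (h \in A).
    by rewrite -[h]mulg1 mem_mulg.
  by rewrite -[h](mulgKV g) mem_mulg // -[h]invgK index2_divg ?groupV.
have := mul_cardG A 'C_D[g]; rewrite AC ZE cardD mulnAC mulnC.
by move/eqP; rewrite eqn_pmul2r ?cardG_gt0 // => /eqP.
Qed.

Lemma sum_card_cent1_sqr :
  (\sum_(g in D) #|'C_D[g]| ^ 2 =
    #|'Z(D)| * (2 * #|A|) ^ 2 + (#|A| - #|'Z(D)|) * #|A| ^ 2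
    + #|A| * (2 * #|'Z(D)|) ^ 2)%N.
Proof.
have sZA := center_sub_abelian_index2.
rewrite (big_setID A) /= (setIidPr sAD) (big_setID 'Z(D)) /= (setIidPr sZA).
congr (_ + _ + _)%N.
- rewrite -sum_nat_const; apply: eq_bigr => g /centerP[Dg cg].
  rewrite -cardD; congr (#|pred_of_set _| ^ 2)%N; apply/setIidPl.
  by apply/subsetP=> h Dh; apply/cent1P/esym/cg.
- have <- : #|A :\: 'Z(D)| = (#|A| - #|'Z(D)|)%N.
    by rewrite cardsD (setIidPr sZA).
  rewrite -sum_nat_const; apply: eq_bigr => g.
  by rewrite inE => /andP[nZg Ag]; rewrite cent1_abelian_index2.
- rewrite -cardDA -sum_nat_const; apply: eq_bigr => g.
  by rewrite inE => /andP[nAg Dg]; rewrite card_cent1_index2.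
Qed.

Lemma card_pair_orbits_index2 :
  (2 * #|pair_orbits D| =
    3 * #|A| * #|'Z(D)| + #|A| ^ 2 + 4 * #|'Z(D)| ^ 2)%N.
Proof.
have := card_pair_orbits D; rewrite sum_card_cent1_sqr cardD.
have := cardG_gt0 A; have := subset_leq_card center_sub_abelian_index2.
move: #|A| #|'Z(D)| #|_| => n d o le_dn n_gt0 e.
apply/eqP; rewrite -(eqn_pmul2l n_gt0); apply/eqP.
(* Writing [n] as [d + (n - d)] removes the truncated subtraction; the identity is the orbit count
   with a factor [n] cancelled. *)
rewrite -(subnKC le_dn) in e *; rewrite addKn in e.
lia.
Qed.

End AbelianIndexTwo.

(** * The presented group: its centre, and the dimension formula *)

(** The centre lies in [A]; for [x] in [A], [f x = x] means commuting with [b], and [A] and [b]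
    generate [D]. *)
Lemma center_D2 (gT : finGroupType) (D A : {group gT}) (b y : gT) (f : {perm gT}) :
    ~~ abelian D -> abelian A -> D2_presentation D A b y f ->
  'Z(D)%g = [set x in A | f x == x].
Proof.
move=> nabelD abelA [sAD indexA genD _ fE].
have sZA := center_sub_abelian_index2 sAD indexA abelA nabelD.
have fixE x : x \in A -> (f x == x) = (x \in 'C[b]%g).
  move=> Ax; rewrite -fE // cent1E -(inj_eq (mulIg b)) mulgKV; exact: eq_sym.
apply/setP=> x; rewrite [RHS]inE; apply/idP/andP=> [Zx | [Ax]].
  have Ax := subsetP sZA x Zx; rewrite fixE //; split=> //.
  have Db : b \in D by rewrite -genD mem_gen ?setU11.
  by have /centerP[_ cx] := Zx; apply/cent1P/cx.
rewrite fixE // => cbx; rewrite inE (subsetP sAD) //.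
rewrite -genD cent_gen; apply/centP=> z; rewrite !inE => /predU1P[-> | Az].
  exact/cent1P.
exact: (centsP abelA).
Qed.

Theorem theorem3p1 (R : realType) (gT : finGroupType) (D A : {group gT})
    (b y : gT) (f : {perm gT})
    (lam mu : nat) (a : 'I_(lam + mu) -> gT) (p e : 'I_(lam + mu) -> nat)
    (s : 'I_(lam + mu) -> int)
    (D_nonabelian : ~~ abelian D)
    (A_abelian : abelian A)
    (A_ge3 : (3 <= #|A|)%N)
    (f_aut : f \in Aut A)
    (f_order : #[f]%g = 2%N)
    (y_in : y \in A)
    (y_fix : f y = y)
    (D_pres : D2_presentation D A b y f)
    (A_dec : (\big[dprod/1]_(i < lam + mu) <[a i]>)%g = A)
    (p_prime : forall i, prime (p i))
    (a_order : forall i, #[a i]%g = (p i ^ e i)%N)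
    (rank_neq0 : (lam + mu)%N <> 0%N)
    (p_eq2 : forall i, p i = 2%N <-> (i < lam)%N)
    (f_pow : forall i x, x \in <[a i]>%g -> f x = expgz x (s i)) :
  let n := #|A| in
  let d := \prod_(i < lam + mu) gcdz (s i - 1) (p i ^ e i)%N%:Z in
  triply_transitive R[i] D /\
  (\dim (terwilliger R[i] D))%:R =
    1 / 2 * (3 * n%:R * d%:~R + n%:R ^+ 2 + 4 * d%:~R ^+ 2) :> rat.
Proof.
move=> n d.
have [sAD indexA _ _ _] := D_pres.
have tD : triply_transitive R[i] D.
  by apply: triply_transitive_criterion; apply: conj_triple_abelian_index2 indexA _.
split=> //; rewrite (terwilliger_triply tD) dim_terwilliger_tilde.
(* The centre is the fixed-point set of [f], which preserves each cyclic factor as it acts there as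
   a power map; so the factorwise counts multiply to [d]. *)
have dE : d = #|'Z(D)%g|.
  rewrite (center_D2 D_nonabelian A_abelian D_pres).
  rewrite (card_bigdprod_fix (H := fun i => <[a i]>%G) A_dec f_aut); last first.
    move=> i x ax; rewrite (f_pow i) //.
    by case: (s i) => k; rewrite /= ?groupV groupX.
  rewrite /d -[RHS]natz natr_prod; apply: eq_bigr => i _.
  rewrite natz /gcdz absz_nat -a_order -card_cycle_expgz_fix.
  congr (Posz #|pred_of_set _|); apply/setP=> x; rewrite !inE.
  by case: (boolP (x \in _)) => //= ax; rewrite (f_pow i).
have := card_pair_orbits_index2 sAD indexA A_abelian D_nonabelian.
move=> /(congr1 (fun k => k%:R : rat)); rewrite dE -/n !natrD !natrM -pmulrn => card_eq.
lra.
Qed.
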